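(* Let $N$ be a positive integer, let $A$ be a modular set modulo $N$, and let $\alpha\in\mathbb{N}$ with $\gcd(\alpha,N)=1$. Let $B=(b_k)_{k\ge 0}$ be a sequence of positive integers such that (i) for each $k$, $3^k$ is the largest power of $3$ dividing $b_k$, and (ii) $b_k=3^k$ for all sufficiently large $k$. Let $S_B$ denote the Stanley sequence generated from the basis $B$. Then $$\alpha\cdot A+N\cdot S_B$$ is a modular Stanley sequence modulo $3^\ell\cdot N$ for all sufficiently large $\ell\in\mathbb{N}$.
   Context: A set of integers is 3-free if it contains no three distinct terms in arithmetic progression. For a finite 3-free set $A=\{a_0<\cdots<a_k\}$ of nonnegative integers, the Stanley sequence $S(A)=(a_n)_{n\ge 0}$ is defined greedily: once $a_0<\cdots<a_n$ (with $n\ge k$) are defined, $a_{n+1}$ is the smallest integer greater than $a_n$ such that $\{a_0,\ldots,a_{n+1}\}$ is 3-free. $S(A)$ is also regarded as a set. For a positive integer $N$ and $A\subseteq\{0,\ldots,N-1\}$: $A$ is 3-free modulo $N$ if there are no $x,y,z\in A$, not all equal, with $2y-z\equiv x\pmod N$; an integer $x$ is covered by $A$ modulo $N$ if there exist $y,z\in A$ with $z<y$ and $2y-z\equiv x\pmod N$. $A$ is a modular set modulo $N$ if $0\in A\subseteq\{0,\ldots,N-1\}$, $A$ is 3-free modulo $N$, and every $x\in\{0,\ldots,N-1\}\setminus A$ is covered by $A$ modulo $N$. A sequence (viewed as a set, listed in increasing order) is a modular Stanley sequence modulo $N$ if it equals $S(A)$ for some modular set $A$ modulo $N$. The Stanley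 sequence generated from the basis $B=(b_k)_{k\ge0}$ is, as a set, $S_B=\{\sum_k\delta_kb_k\mid\delta_k\in\{0,1\},\ \delta_k\ne0\text{ for only finitely many }k\}$. Notation: $X+Y=\{x+y\mid x\in X,\ y\in Y\}$ and $c\cdot X=\{cx\mid x\in X\}$. $\mathbb{N}$ denotes the positive integers. *)

(* Defs.v *)
From mathcomp Require Import all_boot all_order all_algebra.
From mathcomp Require Import classical_sets.

Set Implicit Arguments.
Unset Strict Implicit.
Unset Printing Implicit Defensive.

Local Open Scope classical_set_scope.
Local Open Scope nat_scope.

Definition three_free (A : set nat) : Prop :=
  ~ exists x y z : nat,
      [/\ A x, A y, A z, uniq [:: x; y; z] & x + z = 2 * y].

(* [stanley A a]: the sequence [a] is the Stanley sequence S(A); this relation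
   determines [a] from [A].  The set A = {a_0 < ... < a_k} is the image under
   [a] of `I_k.+1 = {0, ..., k}, hence is finite and nonempty. *)
Definition stanley_candidate (a : nat -> nat) (n m : nat) : Prop :=
  a n < m /\ three_free (a @` `I_n.+1 `|` [set m]).

Definition stanley (A : set nat) (a : nat -> nat) : Prop :=
  three_free A /\
  exists k : nat,
    [/\ forall i j, i < j <= k -> a i < a j,
        A = a @` `I_k.+1
      & forall n, k <= n ->
          stanley_candidate a n (a n.+1) /\
          forall m, stanley_candidate a n m -> a n.+1 <= m].

(* Congruences are taken in [int], as 2y - z may be negative. *)
Definition three_free_mod (N : nat) (A : set nat) : Prop :=
  ~ exists x y z : nat,
      [/\ A x, A y, A z, ~ (x = y /\ y = z)
        & ((2 * y%:Z - z%:Z)%R = x %[mod N])%Z].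

Definition covered_mod (N : nat) (A : set nat) (x : int) : Prop :=
  exists y z : nat,
    [/\ A y, A z, z < y & ((2 * y%:Z - z%:Z)%R = x %[mod N])%Z].

Definition modular_set (N : nat) (A : set nat) : Prop :=
  [/\ A 0, A `<=` `I_N, three_free_mod N A
    & forall x : nat, (`I_N `\` A) x -> covered_mod N A x].

Definition modular_stanley (N : nat) (S : set nat) : Prop :=
  exists (A : set nat) (a : nat -> nat),
    [/\ modular_set N A, stanley A a & S = range a].

Definition basis_set (b : nat -> nat) : set nat :=
  [set n | exists (delta : nat -> bool) (K : nat),
      (forall k, K <= k -> delta k = false) /\
      n = \sum_(k < K) delta k * b k].

Definition sumset (X Y : set nat) : set nat := [set x + y | x in X & y in Y].

Definition dilate (c : nat) (X : set nat) : set nat := [set c * x | x in X].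

(* Main.v *)
Require Import Defs.
From mathcomp Require Import all_boot all_order all_algebra.
From mathcomp Require Import classical_sets.
From mathcomp Require Import boolp zify.

Set Implicit Arguments.
Unset Strict Implicit.
Unset Printing Implicit Defensive.

Local Open Scope classical_set_scope.
Local Open Scope nat_scope.

(** Cut the basis at a level [l] beyond which it consists of powers of 3.  With
    [T] the set of subset sums of b_0, ..., b_(l-1), the set to be recognised
    becomes C + M * S_3, where C = alpha * A + N * T, M = 3 ^ l * N, and S_3 is
    the set of sums of distinct powers of 3 ([basis_set_split]).  Two facts
    finish the proof.

    First, C is a modular set modulo M ([modular_set_digits]).  An element of
    [T] is given by binary digits d_k, and since b_k is 3 ^ k times a number
    prime to 3, digits can be handled one at a time modulo 3, as in ternary
    expansions.  The only solutions of d + f = 2 e modulo 3 with binary digits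
    have d = e = f, so T is 3-free modulo 3 ^ l ([digit_sum_inj_mod]).  On the
    other hand 2 d - e takes all values modulo 3 when (d, e) ranges over
    (0, 0), (1, 1) and (1, 0).  These pairs all have e <= d, so each residue
    modulo 3 ^ l is 2 t - s with s <= t in T ([digit_sum_cover_mod]): this
    monotonicity is what lets the order condition z < y survive when a covering
    modulo N is combined with a covering modulo 3 ^ l.  The residues modulo N
    are reduced to A through an inverse of alpha.  Finally C lies below M once
    3 ^ l dominates alpha plus the sum of the b_k with k < l; this is possible
    because the powers of 3 below 3 ^ l add up to less than half of it.

    Second, the Stanley sequence of any modular set C modulo M enumerates
    C + M * S_3 ([stanley_of_modular]).  Three terms of this set lie in
    C + M * T for a common finite set T of sums of powers of 3, so the first
    fact, with multiplier 1 and basis 3 ^ k, also shows that it is 3-free.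
    Conversely, every m larger than all of C and outside of C + M * S_3 is the
    last term of a progression z < y < m in that set
    ([modular_digits_cover]), so the greedy algorithm skips m. *)

(** * Congruences between natural numbers *)

(** Removes the negative values of 2 y - z, so that all later congruences are
    between natural numbers. *)
Lemma eq_modz_subE (N x y z : nat) :
  ((2 * y%:Z - z%:Z)%R = x %[mod N])%Z <-> 2 * y = x + z %[mod N].
Proof.
have E : ((2 * y%:Z - z%:Z)%R == x %[mod N])%Z = (2 * y == x + z %[mod N]).
  rewrite -(eqz_modDr z%:Z) GRing.subrK -PoszM -PoszD !modz_nat.
  by apply/eqP/eqP => [[]|->].
by split=> /eqP; [rewrite E | rewrite -E] => /eqP.
Qed.

Lemma three_free_modP (N : nat) (A : set nat) (x y z : nat) :
  three_free_mod N A -> A x -> A y -> A z -> 2 * y = x + z %[mod N] ->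
  x = y /\ y = z.
Proof.
move=> free Ax Ay Az E; apply: contra_notP free => nE.
by exists x, y, z; split=> //; apply/eq_modz_subE.
Qed.

Lemma three_free_of_mod (N : nat) (A : set nat) :
  three_free_mod N A -> three_free A.
Proof.
move=> free [x [y [z [Ax Ay Az U E]]]].
have [Exy _] : x = y /\ y = z by apply: (three_free_modP free) => //; rewrite E.
by move: U; rewrite Exy /= inE eqxx.
Qed.

Lemma sub_three_free (A B : set nat) :
  A `<=` B -> three_free B -> three_free A.
Proof.
move=> AB free [x [y [z [Ax Ay Az U E]]]].
by apply: free; exists x, y, z; split=> //; apply: AB.
Qed.

Lemma covered_modP (N : nat) (A : set nat) (x : nat) :
  covered_mod N A x <->
  exists y z : nat, [/\ A y, A z, z < y & 2 * y = x + z %[mod N]].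
Proof.
by split=> -[y [z [Ay Az zy E]]]; exists y, z; split=> //; apply/eq_modz_subE.
Qed.

(** The quotient (X - Y) / N may be negative; only its class modulo P matters,
    and this class has a natural representative. *)
Lemma eqn_mod_lift (P N X Y : nat) :
  0 < P -> X = Y %[mod N] -> exists m, X = Y + N * m %[mod P * N].
Proof.
move=> P0 E; case: (leqP Y X) => [YX|/ltnW XY].
  have /dvdnP[w W] : N %| X - Y by rewrite -eqn_mod_dvd //; apply/eqP.
  by exists w; rewrite (mulnC N) -W subnKC.
have /dvdnP[w W] : N %| Y - X by rewrite -eqn_mod_dvd //; apply/eqP.
exists (w * P.-1).
have -> : Y + N * (w * P.-1) = w * (P * N) + X by case: P P0 => // P _; nia.
by rewrite modnMDl.
Qed.

Lemma coprime_inv_mod (a N : nat) :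
  0 < a -> coprime a N -> exists a', a * a' = 1 %[mod N].
Proof.
move=> a0 cop; case: (egcdnP N a0) => u v E _; exists u.
by rewrite mulnC E (eqP cop) modnMDl.
Qed.

(** * Subset sums of a sequence whose k-th term has 3-adic valuation k *)

Definition digit_sum (b : nat -> nat) (d : nat -> bool) (l : nat) : nat :=
  \sum_(k < l) d k * b k.

Definition subset_sums (b : nat -> nat) (l : nat) : set nat :=
  [set digit_sum b d l | d in [set: nat -> bool]].

Definition pow3 (k : nat) : nat := 3 ^ k.

Definition valued3 (b : nat -> nat) : Prop :=
  forall k, exists2 u, b k = 3 ^ k * u & ~~ (3 %| u).

Lemma valued3_logn (b : nat -> nat) :
  (forall k, 0 < b k) -> (forall k, logn 3 (b k) = k) -> valued3 b.
Proof.
move=> b0 bv k; have [//|u cop E] := @pfactor_coprime 3 (b k) _ (b0 k).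
by exists u; [rewrite mulnC E bv | rewrite -prime_coprime].
Qed.

Lemma valued3_pow3 : valued3 pow3.
Proof. by move=> k; exists 1; rewrite // muln1. Qed.

Lemma digit_sumS b d l : digit_sum b d l.+1 = digit_sum b d l + d l * b l.
Proof. by rewrite /digit_sum big_ord_recr. Qed.

Lemma eq_digit_sum b d e l :
  (forall k, k < l -> d k = e k) -> digit_sum b d l = digit_sum b e l.
Proof. by move=> E; apply: eq_bigr => k _; rewrite E. Qed.

Lemma digit_sum_set b (d : nat -> bool) x l :
  digit_sum b (fun k => if k == l then x else d k) l.+1
  = digit_sum b d l + x * b l.
Proof.
rewrite digit_sumS eqxx; congr (_ + _).
by apply: eq_digit_sum => k kl; rewrite ltn_eqF.
Qed.

Lemma leq_digit_sum b (d e : nat -> bool) l :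
  (forall k, d k -> e k) -> digit_sum b d l <= digit_sum b e l.
Proof.
move=> de; apply: leq_sum => k _; rewrite leq_mul2r.
by case: (d k) (@de k) => [->//|_]; rewrite orbT.
Qed.

Lemma digit_sum_le b d l : digit_sum b d l <= \sum_(k < l) b k.
Proof. by apply: leq_sum => k _; case: (d k); rewrite /= ?mul1n. Qed.

Lemma sum_pow3 l : 2 * (\sum_(k < l) pow3 k) + 1 = 3 ^ l.
Proof.
elim: l => [|l IH]; first by rewrite big_ord0.
rewrite big_ord_recr /= expnS; set s := \sum_(i < l) _ in IH *; rewrite -[pow3 l]IH. lia.
Qed.

(** Modulo 3 ^ l the term b_l vanishes, so the lower digits are controlled by
    induction; what is left is a multiple of 3 ^ l, and dividing by it turns the
    top digits into a solution of d + f = 2 e modulo 3. *)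
Lemma digit_sum_inj_mod b (hb : valued3 b) (d e f : nat -> bool) l :
  2 * digit_sum b e l = digit_sum b d l + digit_sum b f l %[mod 3 ^ l] ->
  digit_sum b d l = digit_sum b e l /\ digit_sum b e l = digit_sum b f l.
Proof.
elim: l => [|l IH]; first by rewrite /digit_sum !big_ord0.
rewrite !digit_sumS => E.
have [u bE u3] := hb l; rewrite !{}bE {hb} in E.
have [Ede Eef] : digit_sum b d l = digit_sum b e l
                 /\ digit_sum b e l = digit_sum b f l.
  apply: IH; have := congr1 (modn^~ (3 ^ l)) E.
  rewrite /= !modn_dvdm ?dvdn_exp2l //.
  set X := digit_sum b d l; set Y := digit_sum b e l; set Z := digit_sum b f l.
  have -> : 2 * (Y + e l * (3 ^ l * u)) = 2 * e l * u * 3 ^ l + 2 * Y by lia.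
  have -> : X + d l * (3 ^ l * u) + (Z + f l * (3 ^ l * u))
            = (d l + f l) * u * 3 ^ l + (X + Z) by lia.
  by rewrite !modnMDl.
move: E; rewrite {}Ede -{}Eef; set Y := digit_sum b e l.
have -> : 2 * (Y + e l * (3 ^ l * u)) = 2 * Y + 3 ^ l * (2 * e l * u) by lia.
have -> : Y + d l * (3 ^ l * u) + (Y + f l * (3 ^ l * u))
          = 2 * Y + 3 ^ l * ((d l + f l) * u) by lia.
move/eqP; rewrite eqn_modDl expnSr -!muln_modr eqn_pmul2l ?expn_gt0 // => /eqP.
case: (d l); case: (e l); case: (f l) => /= E //; lia.
Qed.

(** The residue left over at 3 ^ l is absorbed by one of the digit pairs
    (0, 0), (1, 1), (1, 0), whose values 2 d - e are 0, 1, 2.  The pair (0, 1),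
    also of value 2 modulo 3, is avoided in order to keep e <= d. *)
Lemma digit_sum_cover_mod b (hb : valued3 b) l m :
  exists d e : nat -> bool, (forall k, e k -> d k) /\
    2 * digit_sum b d l = m + digit_sum b e l %[mod 3 ^ l].
Proof.
elim: l => [|l [d [e [ed E]]]].
  by exists xpred0, xpred0; split=> //; rewrite !modn1.
have [w {}E] := eqn_mod_lift (isT : 0 < 3) (esym E).
have [u bE u3] := hb l.
(* The pair (d', e') gives the new digits of index l; the lower ones are kept. *)
suff [d' [e' [ed' W]]] : exists d' e' : bool, (e' -> d') /\
    2 * d' * u = w + e' * u %[mod 3].
  exists (fun k => if k == l then d' else d k).
  exists (fun k => if k == l then e' else e k).
  split=> [k|]; first by case: (k == l) => //; apply: ed.
  rewrite !digit_sum_set bE expnS addnA -(modnDml (m + _)) {}E modnDml mulnDr.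
  set D := 2 * digit_sum b d l; apply/eqP.
  have -> : D + 2 * (d' * (3 ^ l * u)) = D + 3 ^ l * (2 * d' * u) by lia.
  have -> : D + 3 ^ l * w + e' * (3 ^ l * u) = D + 3 ^ l * (w + e' * u) by lia.
  by rewrite eqn_modDl (mulnC 3) -!muln_modr W.
have [W|W|W] : [\/ w = 0 %[mod 3], w = u %[mod 3] | w = 2 * u %[mod 3]].
- have : w %% 3 \in [:: 0; u %% 3; 2 * u %% 3] by rewrite !inE; lia.
  rewrite !inE => /or3P[] /eqP ->; [apply: Or31|apply: Or32|apply: Or33] => //.
- by exists false, false; split=> //; rewrite !mul0n addn0 W.
- by exists true, true; split=> //; rewrite muln1 mul1n -modnDml W modnDml addnn mul2n.
- by exists true, false; split=> //; rewrite muln1 mul0n addn0 W.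
Qed.

Lemma subset_sums_widen b l j : subset_sums b l `<=` subset_sums b (l + j).
Proof.
move=> _ [d _ <-]; exists (fun k => (k < l) && d k) => //.
rewrite /digit_sum big_split_ord /= [X in _ + X]big1 => [|k _].
  by rewrite addn0; apply: eq_bigr => k _; rewrite ltn_ord.
by rewrite /= ltnNge leq_addr.
Qed.

Lemma basis_setE b : basis_set b = \bigcup_l subset_sums b l.
Proof.
apply/seteqP; split=> [n [d [K [_ ->]]]|n [l _ [d _ <-]]].
  by exists K => //; exists d.
exists (fun k => (k < l) && d k), l; split=> [k|]; first by rewrite ltnNge => ->.
by apply: eq_bigr => k _; rewrite ltn_ord.
Qed.

Lemma basis_set_split b l (tail : forall k, l <= k -> b k = 3 ^ k) :
  basis_set b = sumset (subset_sums b l) (dilate (3 ^ l) (basis_set pow3)).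
Proof.
have splitE d j : digit_sum b d (l + j)
    = digit_sum b d l + 3 ^ l * digit_sum pow3 (fun k => d (l + k)) j.
  rewrite /digit_sum big_split_ord /= big_distrr /=; congr (_ + _).
  by apply: eq_bigr => k _; rewrite tail ?leq_addr // /pow3 expnD; lia.
rewrite !basis_setE; apply/seteqP; split=> [n [j _ /(@subset_sums_widen _ _ l)]|].
  rewrite addnC => -[d _ <-]; rewrite splitE.
  exists (digit_sum b d l); first by exists d.
  exists (3 ^ l * digit_sum pow3 (fun k => d (l + k)) j) => //.
  by exists (digit_sum pow3 (fun k => d (l + k)) j) => //; exists j => //; eexists.
move=> _ [_ [d _ <-] [_ [_ [j _ [e _ <-]] <-] <-]].
exists (l + j) => //; exists (fun k => if k < l then d k else e (k - l)) => //.
rewrite splitE; congr (_ + _ * _); apply: eq_digit_sum => k.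
  by move=> ->.
by move=> _; rewrite ltnNge leq_addr addKn.
Qed.

(** For the powers of 3 the covering modulo 3 ^ q is an equality, because both
    q and 2 y - z lie in the interval from 0 to 3 ^ q - 1. *)
Lemma ternary_cover q : exists y z,
  [/\ basis_set pow3 y, basis_set pow3 z, z <= y & 2 * y = q + z].
Proof.
have [d [e [ed E]]] := digit_sum_cover_mod valued3_pow3 q q.
have q_lt : q < 3 ^ q by apply: ltn_expl.
have zy := leq_digit_sum pow3 q ed.
have := digit_sum_le pow3 d q; have := sum_pow3 q.
move: zy E; set y := digit_sum pow3 d q; set z := digit_sum pow3 e q.
move=> zy E sumE le_y; exists y, z.
split=> //; rewrite ?basis_setE; try by exists q => //; eexists.
suff : 2 * y - z = q by lia.
have /eqP : (2 * y - z) + z = q + z %[mod 3 ^ q] by rewrite subnK //; lia.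
by rewrite eqn_modDr !modn_small => [/eqP|//|]; lia.
Qed.

(** * Dilating a modular set and adjoining digits *)

(** Reduction modulo N separates the A-part from the digit part.  In the
    covering statement the lower part only provides z <= y, with equality
    allowed, and so do the digits; were both equalities, x would be congruent
    to, hence equal to, an element of the set. *)
Lemma modular_set_digits N A a b l :
  modular_set N A -> 0 < a -> coprime a N -> valued3 b ->
  a + \sum_(k < l) b k <= 3 ^ l ->
  modular_set (3 ^ l * N) (sumset (dilate a A) (dilate N (subset_sums b l))).
Proof.
move=> [A0 AN free cov] a0 cop hb small; set S := sumset _ _.
have SI x t : A x -> subset_sums b l t -> S (a * x + N * t).
  by move=> Ax Tt; exists (a * x); [exists x | exists (N * t) => //; exists t].
have SE n : S n -> exists x d, A x /\ n = a * x + N * digit_sum b d l.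
  by move=> [_ [x Ax <-] [_ [_ [d _ <-] <-] <-]]; exists x, d.
have N0 : 0 < N by apply: leq_ltn_trans (AN _ A0).
have [a' aa'] := coprime_inv_mod a0 cop.
have S_lt : S `<=` `I_(3 ^ l * N).
  move=> _ /SE[x [d [/AN /= xN ->]]].
  apply: (@leq_trans ((a + \sum_(k < l) b k) * N)); last by rewrite leq_mul2r small orbT.
  rewrite mulnDl -addSn leq_add ?ltn_pmul2l // mulnC leq_mul2r.
  by rewrite digit_sum_le orbT.
split=> //.
- exists (a * 0) ; first by exists 0.
  exists (N * digit_sum b xpred0 l); last by rewrite /digit_sum big1 ?muln0.
  by eexists => //; exists xpred0.
- move=> [_ [_ [_ [/SE[x [d [Ax ->]]] /SE[y [e [Ay ->]]] /SE[z [f [Az ->]]]]]]].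
  move=> neq /eq_modz_subE E; apply: neq.
  have [xy yz] : x = y /\ y = z.
    apply: (three_free_modP free Ax Ay Az).
    have : a' * (2 * (a * y + N * digit_sum b e l)) =
           a' * (a * x + N * digit_sum b d l + (a * z + N * digit_sum b f l))
           %[mod N].
      have := congr1 (modn^~ N) E; rewrite !modn_dvdm ?dvdn_mull // => EN.
      by rewrite -modnMmr EN modnMmr.
    set s := digit_sum b d l; set t := digit_sum b e l; set r := digit_sum b f l.
    have -> : a' * (2 * (a * y + N * t)) = (a' * 2 * t) * N + (a * a') * (2 * y) by lia.
    have -> : a' * (a * x + N * s + (a * z + N * r))
       = (a' * (s + r)) * N + (a * a') * (x + z) by lia.
    by rewrite !modnMDl -modnMml aa' modnMml mul1n -[in RHS]modnMml aa' modnMml mul1n.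
  move: E; rewrite {}xy -{}yz.
  set s := digit_sum b d l; set t := digit_sum b e l; set r := digit_sum b f l.
  have -> : 2 * (a * y + N * t) = 2 * a * y + N * (2 * t) by lia.
  have -> : a * y + N * s + (a * y + N * r) = 2 * a * y + N * (s + r) by lia.
  move/eqP; rewrite eqn_modDl (mulnC _ N) -!muln_modr eqn_pmul2l // => /eqP E.
  by have [-> ->] : s = t /\ t = r := digit_sum_inj_mod hb E.
- move=> x [/= x_lt nSx]; apply/covered_modP.
  have x'N : a' * x %% N < N by rewrite ltn_mod.
  have aa'x w : a * (a' * x %% N + w) = x + a * w %[mod N].
    by rewrite mulnDr -modnDml modnMmr mulnA -(modnMml (a * a')) aa' modnMml mul1n modnDml.
  have [y [z [Ay Az zy E]]] : exists y z,
      [/\ A y, A z, z <= y & 2 * y = a' * x %% N + z %[mod N]].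
    have [Ax'|nAx'] := pselect (A (a' * x %% N)).
      by exists (a' * x %% N), (a' * x %% N); split=> //; rewrite addnn mul2n.
    have /covered_modP[y [z [Ay Az zy E]]] := cov _ (conj x'N nAx').
    by exists y, z; split=> //; apply: ltnW.
  have /(@eqn_mod_lift (3 ^ l))[|m Em] : x + a * z = 2 * (a * y) %[mod N].
  + by rewrite -aa'x -modnMmr -E modnMmr mulnCA.
  + by rewrite expn_gt0.
  have [d [e [ed {}E]]] := digit_sum_cover_mod hb l m.
  have le_ed := leq_digit_sum b l ed.
  have Ey : 2 * (a * y + N * digit_sum b d l)
      = x + (a * z + N * digit_sum b e l) %[mod 3 ^ l * N].
    rewrite addnA -(modnDml (x + _)) Em modnDml -addnA -(mulnDr N).
    apply/eqP; rewrite mulnDr eqn_modDl mulnCA (mulnC _ N) -!muln_modr.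
    by rewrite E.
  have Sy : S (a * y + N * digit_sum b d l) by apply: SI => //; exists d.
  have Sz : S (a * z + N * digit_sum b e l) by apply: SI => //; exists e.
  exists (a * y + N * digit_sum b d l), (a * z + N * digit_sum b e l); split=> //.
  have : a * z + N * digit_sum b e l <= a * y + N * digit_sum b d l.
    by rewrite leq_add // leq_mul2l ?zy ?le_ed orbT.
  rewrite leq_eqVlt => /orP[/eqP zyE|//]; case: nSx.
  move: Ey; rewrite zyE mul2n -addnn => /eqP; rewrite eqn_modDr.
  by rewrite !modn_small // ?(S_lt _ Sy) // => /eqP <-.
Qed.

(** * Stanley sequences started from a modular set *)

Lemma increasing_enumeration (S : set nat) :
  (forall n, exists2 m, n <= m & S m) ->
  exists a : nat -> nat, (forall n, a n < a n.+1) /\ range a = S.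
Proof.
move=> unbounded.
have ex n : exists m, (n <= m) && `[< S m >].
  by have [m nm Sm] := unbounded n; exists m; rewrite nm; apply/asboolP.
pose next n := ex_minn (ex n).
have nextP n : [/\ n <= next n, S (next n) & forall m, n <= m -> S m -> next n <= m].
  rewrite /next; case: ex_minnP => p /andP[np /asboolP Sp] min_p.
  by split=> // m nm Sm; apply: min_p; rewrite nm; apply/asboolP.
pose a n := iter n (fun p => next p.+1) (next 0).
have aS n : a n < a n.+1 by have [] := nextP (a n).+1.
exists a; split=> //; apply/seteqP; split=> [_ [n _ <-]|s Ss].
  by case: n => [|n]; [have [] := nextP 0 | have [] := nextP (a n).+1].
have ex_s : exists n, s <= a n.
  exists s; elim: s {Ss} => // s IH; exact: leq_ltn_trans IH (aS s).
case: (ex_minnP ex_s) => n sn min_n; exists n => //.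
apply/eqP; rewrite eqn_leq sn andbT.
case: n sn min_n => [|n] _ min_n; first by have [_ _] := nextP 0; apply.
have [_ _] := nextP (a n).+1; apply=> //.
by rewrite ltnNge; apply/negP => /min_n; rewrite ltnn.
Qed.

Lemma increasing_ltn (a : nat -> nat) :
  (forall n, a n < a n.+1) -> {mono a : i j / i < j}.
Proof. by move=> /(homo_ltn ltn_trans) /leq_mono /leqW_mono. Qed.

(** Any three elements use finitely many digits in total, and up to a fixed
    number of digits the set is 3-free even modulo a multiple of M. *)
Lemma modular_digits_three_free M C :
  modular_set M C -> three_free (sumset C (dilate M (basis_set pow3))).
Proof.
move=> hC [x [y [z [Sx Sy Sz U E]]]].
have lvl n : sumset C (dilate M (basis_set pow3)) n -> exists l, forall j,
    sumset (dilate 1 C) (dilate M (subset_sums pow3 (l + j))) n.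
  move=> [c Cc [_ [t Bt <-] <-]]; move: Bt; rewrite basis_setE => -[l _ Tt].
  exists l => j; exists c; first by exists c; rewrite ?mul1n.
  by exists (M * t) => //; exists t => //; apply: subset_sums_widen.
have [i Si] := lvl x Sx; have [j Sj] := lvl y Sy; have [k Sk] := lvl z Sz.
have small : 1 + \sum_(m < i + j + k) pow3 m <= 3 ^ (i + j + k).
  have := sum_pow3 (i + j + k); set s := \sum_(_ < _) _; lia.
have [_ _ free _] :=
  modular_set_digits hC (isT : 0 < 1) (coprime1n M) valued3_pow3 small.
apply: (three_free_of_mod free); exists x, y, z; split=> //.
- by rewrite -addnA; apply: Si.
- by rewrite (addnC i) -addnA; apply: Sj.
- by rewrite addnC; apply: Sk.
Qed.

(** With r = m mod M, a covering r + d = 2 c modulo M may wrap around once, as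
    2 c - d < 2 M; the wrap is taken from the quotient m / M, which cannot be 0
    in that case: m < M and m + M + d = 2 c with c < M would give c > m. *)
Lemma modular_digits_cover M C m :
  modular_set M C -> (forall c, C c -> c < m) ->
  ~ sumset C (dilate M (basis_set pow3)) m ->
  exists y z, [/\ sumset C (dilate M (basis_set pow3)) y,
    sumset C (dilate M (basis_set pow3)) z, z < y & 2 * y = m + z].
Proof.
move=> [C0 CM free cov] Cm nSm.
have M0 : 0 < M by apply: leq_ltn_trans (CM _ C0).
have SI c t : C c -> basis_set pow3 t ->
    sumset C (dilate M (basis_set pow3)) (c + M * t).
  by move=> Cc Bt; exists c => //; exists (M * t) => //; exists t.
suff [q [c [d [Cc Cd dc E]]]] : exists q c d,
    [/\ C c, C d, d <= c & m + d = 2 * c + M * q].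
  have [t [s [Bt Bs st Et]]] := ternary_cover q.
  have zy : d + M * s <= c + M * t by rewrite leq_add // leq_mul2l st orbT.
  have Ey : 2 * (c + M * t) = m + (d + M * s).
    by rewrite addnA E mulnDr mulnCA Et mulnDr addnA.
  exists (c + M * t), (d + M * s); split=> //; try exact: SI.
  rewrite ltn_neqAle zy andbT; apply/eqP => zyE; apply: nSm.
  by have -> : m = c + M * t; [lia | exact: SI].
have rM : m %% M < M by rewrite ltn_mod.
have mE := divn_eq m M.
have [Cr|nCr] := pselect (C (m %% M)).
  by exists (m %/ M), (m %% M), (m %% M); split=> //; lia.
have /covered_modP[c [d [Cc Cd dc E]]] := cov _ (conj rM nCr).
have cM : c < M := CM _ Cc.
have cm := Cm _ Cc.
have [E0|E1] : 2 * c = m %% M + d \/ 2 * c = m %% M + d + M.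
  have /dvdnP[w W] : M %| 2 * c + M - (m %% M + d).
    rewrite -eqn_mod_dvd; last by lia.
    by rewrite modnDr E.
  have : w < 3 by nia.
  have : 0 < w by nia.
  case: w W => [|[|[|w]]] // W _ _; [left|right]; lia.
- exists (m %/ M), c, d; split=> //; [exact: ltnW | lia].
- exists (m %/ M).-1, c, d; split=> //; first exact: ltnW.
  case: (m %/ M) mE => [|q] mE /=; nia.
Qed.

(** The greedy sequence is the increasing enumeration of C + M * S_3; the index
    where C ends is the last one with a value below M. *)
Lemma stanley_of_modular M C :
  modular_set M C ->
  exists2 a, stanley C a & sumset C (dilate M (basis_set pow3)) = range a.
Proof.
move=> hC; have [C0 CM free _] := hC; set S := sumset _ _.
have M0 : 0 < M by apply: leq_ltn_trans (CM _ C0).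
have CS : C `<=` S.
  move=> c Cc; exists c => //; exists 0; rewrite ?addn0 //.
  by exists 0; rewrite ?muln0 //; exists xpred0, 0; rewrite big_ord0.
have SM n : S n -> n < M -> C n.
  move=> [c Cc [_ [[|t] _ <-] <-]]; first by rewrite muln0 addn0.
  by rewrite mulnS; lia.
have unbounded n : exists2 m, n <= m & S m.
  exists (M * 3 ^ n).
    by apply: leq_trans (ltnW (ltn_expl n (isT : 1 < 3))) (leq_pmull _ M0).
  exists 0 => //; exists (M * 3 ^ n) => //; exists (3 ^ n) => //.
  exists (pred1 n), n.+1; split=> [k nk|]; first by rewrite /= gtn_eqF.
  rewrite big_ord_recr /= eqxx mul1n big1 // => k _.
  by rewrite ltn_eqF.
have [a [aS rangeS]] := increasing_enumeration unbounded.
exists a => //.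
have mono := increasing_ltn aS.
have Sa n : S (a n) by rewrite -rangeS; exists n.
have n_le n : n <= a n by elim: n => // n IH; apply: leq_ltn_trans IH (aS n).
have aE s : S s -> exists n, a n = s by rewrite -rangeS => -[n _ <-]; exists n.
split; first exact: three_free_of_mod free.
have [i0 a0] := aE 0 (CS 0 C0).
have exM : exists k, a k < M by exists i0; rewrite a0.
have leM k : a k < M -> k <= M by move=> akM; apply: leq_trans (n_le k) (ltnW akM).
case: (ex_maxnP exM leM) => k akM max_k; exists k; split.
- by move=> i j /andP[ij _]; rewrite mono.
- apply/seteqP; split=> [c Cc|_ [i /= ik <-]].
    have [i ai] := aE c (CS c Cc); exists i => //=.
    by rewrite ltnS; apply: max_k; rewrite ai; apply: CM.
  by apply: SM => //; apply: leq_ltn_trans akM; rewrite leqNgt mono -leqNgt.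
- move=> n kn; split.
    split; first by rewrite mono.
    apply: sub_three_free (modular_digits_three_free hC) => s.
    by move=> [[i _ <-]|->]; exact: Sa.
  move=> m [anm cand]; rewrite leqNgt; apply/negP => m_lt; apply: cand.
  have nSm : ~ S m.
    by move=> /aE[i mi]; move: anm m_lt; rewrite -mi !mono; lia.
  have Cm c : C c -> c < m.
    move=> Cc; have [i ai] := aE c (CS c Cc).
    apply: leq_ltn_trans anm; rewrite -ai leqNgt mono -leqNgt.
    by apply: leq_trans kn; apply: max_k; rewrite ai; apply: CM.
  have [y [z [Sy Sz zy E]]] := modular_digits_cover hC Cm nSm.
  have below s : S s -> s < m -> (a @` `I_n.+1) s.
    move=> /aE[i <-] sm; exists i => //=.
    by rewrite -mono; apply: leq_trans m_lt; apply: ltnW.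
  exists z, y, m; split.
  + by left; apply: below => //; lia.
  + by left; apply: below => //; lia.
  + by right.
  + by rewrite /= !inE !negb_or; apply/and3P; split=> //; lia.
  + by rewrite E addnC.
Qed.

Theorem theorem4p6 (N : nat) (A : set nat) (alpha : nat) (b : nat -> nat)
  (hN : 0 < N) (hA : modular_set N A)
  (halpha : 0 < alpha) (hcop : coprime alpha N)
  (hb_pos : forall k, 0 < b k)
  (hb_val : forall k, logn 3 (b k) = k)
  (hb_tail : exists K, forall k, K <= k -> b k = 3 ^ k) :
  exists L, forall l, L <= l ->
    modular_stanley (3 ^ l * N)
      (sumset (dilate alpha A) (dilate N (basis_set b))).
Proof.
have [K tail] := hb_tail; pose s := \sum_(k < K) b k.
(* The b_k with k < l add up to less than s + 3 ^ l / 2, while alpha + s <= l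
   and 2 l <= 3 ^ l. *)
exists (K + alpha + s) => l Ll.
have small : alpha + \sum_(k < l) b k <= 3 ^ l.
  have lE : l = K + (l - K) by lia.
  have sumE : \sum_(k < l) b k <= s + \sum_(k < l) pow3 k.
    rewrite lE !big_split_ord /= leq_add2l.
    rewrite (eq_bigr (fun k : 'I_(l - K) => pow3 (K + k))) ?leq_addl //.
    by move=> k _; rewrite tail ?leq_addr.
  have := sum_pow3 l; have : l.*2 <= 3 ^ l.
    by elim: (l) => // n IH; rewrite expnS; case: n IH => // n; lia.
  move: sumE; set p := \sum_(k < l) pow3 k; lia.
have hC := modular_set_digits hA halpha hcop (valued3_logn hb_pos hb_val) small.
have [a stanley_a rangeE] := stanley_of_modular hC.
exists (sumset (dilate alpha A) (dilate N (subset_sums b l))), a; split=> //.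
rewrite -rangeE (@basis_set_split b l) => [|k lk]; last by apply: tail; lia.
apply/seteqP; split=> n.
  move=> [x Ax [_ [_ [t Tt [_ [u Bu <-] <-]] <-] <-]].
  exists (x + N * t); first by exists x => //; exists (N * t) => //; exists t.
  exists (3 ^ l * N * u); first by exists u.
  by rewrite mulnDr addnA mulnA (mulnC (3 ^ l)).
move=> [_ [x Ax [_ [t Tt <-] <-]] [_ [u Bu <-] <-]].
exists x => //; exists (N * (t + 3 ^ l * u)).
  exists (t + 3 ^ l * u) => //; exists t => //.
  by exists (3 ^ l * u) => //; exists u.
by rewrite mulnDr addnA mulnA (mulnC (3 ^ l)).
Qed.
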